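(* Let $f:\mathbb{R}_+\to\mathbb{R}$ be a convex nonincreasing function such that the equation $f(\tau)=0$ has a solution, and let $\tau_*$ denote the minimal root of $f(\tau)=0$. Let $\epsilon>0$, let $\alpha\in(1,2)$, let $\tau_0\ge0$ satisfy $f(\tau_0)>0$, and let $\mathcal{O}_f$ be an affine minorant oracle for $f$. Then the inexact Newton method (defined in the context) applied to these data terminates after at most $$\max\left\{\,1+\log_{2/\alpha}\left(2C/\epsilon\right),\ 2\,\right\}$$ iterations, where $C:=\max\{\,|s_0|(\tau_*-\tau_0),\ \ell_0\,\}$ and $(\ell_0,u_0,s_0)=\mathcal{O}_f(\tau_0,\alpha)$.
   Context: Write $[f>0]:=\{\tau\in\mathbb{R}_+ : f(\tau)>0\}$. Affine minorant oracle: for a function $f:\mathbb{R}_+\to\mathbb{R}$, an affine minorant oracle is a map $\mathcal{O}_f$ that assigns to each pair $(\tau,\alpha)\in[f>0]\times[1,\infty)$ real numbers $(\ell,u,s)$ such that $0<\ell\le f(\tau)\le u$ and $u/\ell\le\alpha$, and the affine function $\tau'\mapsto\ell+s(\tau'-\tau)$ globally minorizes $f$, i.e. $\ell+s(\tau'-\tau)\le f(\tau')$ for all $\tau'\in\mathbb{R}_+$. Inexact Newton method, with input $f$ (accessed via $\mathcal{O}_f$), $\epsilon>0$, $\alpha\in(1,2)$ and $\tau_0$: set $u_{-1}:=+\infty$. Then for $k=0,1,2,\dots$ perform the following iteration: (0) if $f(\tau_k)=0$, terminate and return $\tau_k$; (1) obtain $(\ell_k,u_k,s_k):=\mathcal{O}_f(\tau_k,\alpha)$;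 (2) replace $u_k$ by $\min\{u_k,u_{k-1}\}$; (3) if $u_k\le\epsilon$, terminate and return $\tau_k$; (4) otherwise set $\tau_{k+1}:=\tau_k-\ell_k/s_k$, and continue with $k+1$. The number of iterations is the number of indices $k\ge0$ for which this loop is entered. *)

(* Defs.v *)
From HB Require Import structures.
From mathcomp Require Import all_boot all_order all_algebra.
From mathcomp Require Import all_classical all_reals all_analysis.

Set Implicit Arguments.
Unset Strict Implicit.
Unset Printing Implicit Defensive.

Import Order.TTheory GRing.Theory Num.Theory.

Local Open Scope classical_set_scope.
Local Open Scope ring_scope.

(* A function on the nonnegative reals is a total function [f : R -> R], of
   which only the values on [Rplus R] are ever constrained or used. *)
Definition Rplus (R : realType) : set R := [set t | 0 <= t].
Arguments Rplus R : clear implicits.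

Definition nonincreasing_on (R : realType) (D : set R) (f : R -> R) : Prop :=
  {in D &, {homo f : x y /~ x <= y}}.

Definition minimal_root (R : realType) (f : R -> R) (t : R) : Prop :=
  [/\ 0 <= t, f t = 0 & forall t' : R, 0 <= t' -> f t' = 0 -> t <= t'].

(* The set [f > 0], as a boolean predicate. *)
Definition fpos (R : realType) (f : R -> R) : pred R :=
  fun t => (0 <= t) && (0 < f t).

(* [O t alpha = (l, u, s)]; the values of [O] outside [f > 0] x [1, oo) are
   unconstrained, and [newton_step] never uses them. *)
Definition affine_minorant_oracle (R : realType) (f : R -> R)
    (O : R -> R -> R * R * R) : Prop :=
  forall t alpha : R, fpos f t -> 1 <= alpha ->
    let: (l, u, s) := O t alpha in
    [/\ 0 < l <= f t, f t <= u, u / l <= alpha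
      & forall t' : R, 0 <= t' -> l + s * (t' - t) <= f t'].

(* [Running t u]: the next iteration is entered with current iterate [t] and
   previous upper bound [u], which is +oo initially.
   [Returned t]: the method has terminated and returned [t].
   [Stuck]: the iteration is undefined (the oracle was called outside its
   domain, or a Newton step would divide by zero); this is not termination. *)
Inductive newton_state (R : realType) : Type :=
  | Running of R & \bar R
  | Returned of R
  | Stuck.
Arguments Stuck {R}.

Definition newton_step (R : realType) (f : R -> R) (O : R -> R -> R * R * R)
    (eps alpha : R) (st : newton_state R) : newton_state R :=
  if st is Running t uprev then
    if (0 <= t) && (f t == 0) then Returned t
    else if ~~ (fpos f t && (1 <= alpha)) then Stuck
    else
      let: (l, u, s) := O t alpha in
      let u' := Order.min u%:E uprev in
      if (u' <= eps%:E)%E then Returned t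
      else if s == 0 then Stuck
      else Running (t - l / s) u'
  else st.

Definition newton_run (R : realType) (f : R -> R) (O : R -> R -> R * R * R)
    (eps alpha t0 : R) (n : nat) : newton_state R :=
  iter n (newton_step f O eps alpha) (Running t0 +oo%E).

(* The loop is entered exactly for the indices k = 0, ..., N - 1, and the
   method returns during the last of these N iterations. *)
Definition newton_terminates_after (R : realType) (f : R -> R)
    (O : R -> R -> R * R * R) (eps alpha t0 : R) (N : nat) : Prop :=
  (forall k, (k < N)%N ->
     exists t u, newton_run f O eps alpha t0 k = Running t u) /\
  exists t, newton_run f O eps alpha t0 N = Returned t.

Definition logb (R : realType) (b x : R) : R := ln x / ln b.

(* Main.v *)
(** At two consecutive iterates, evaluating the second minorant at the first
    iterate gives [l'/l + s'/s <= alpha], so by AM-GM the product [l * |s|]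
    shrinks by the factor [(alpha/2)^2]. Since the minorant at [t] is
    nonpositive at the root, [l <= |s| * (taus - t)], hence
    [l^2 <= (l * |s|) * (taus - t)] and [l <= (alpha/2)^k * C] at step [k].
    A step that does not terminate has [eps < u <= alpha * l], which bounds
    [k]. *)
Require Import Defs.
From mathcomp Require Import all_boot all_order all_algebra.
From mathcomp Require Import all_classical all_reals all_analysis.
From mathcomp Require Import ring lra.
Import Order.TTheory GRing.Theory Num.Theory.
Local Open Scope classical_set_scope.
Local Open Scope ring_scope.

(** Dividing the hypothesis by [l] bounds the sum of the ratios [a = l' / l] and [b = s' / s] by
    [alpha], and [4ab = (a + b)^2 - (a - b)^2]. *)
Lemma product_contraction (R : realFieldType) (alpha l s l' s' : R) :
  0 < l -> s < 0 -> 0 < l' -> s' < 0 -> l' + s' * (l / s) <= alpha * l ->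
  l' * - s' <= (alpha / 2) ^+ 2 * (l * - s).
Proof.
move=> l0 s0 l'0 s'0 H.
have sN0 : s != 0 by rewrite lt_eqF.
have lN0 : l != 0 by rewrite gt_eqF.
pose a := l' / l; pose b := s' / s.
have a0 : 0 < a by rewrite divr_gt0.
have b0 : 0 < b by rewrite /b -mulrNN -invrN divr_gt0 ?oppr_gt0.
have ab : a + b <= alpha.
  rewrite -(ler_pM2r l0) (le_trans _ H) // le_eqVlt; apply/orP; left; apply/eqP.
  by rewrite /a /b; field; rewrite sN0 lN0.
have -> : l' = a * l by rewrite /a divfK.
have -> : s' = b * s by rewrite /b divfK.
have -> : a * l * - (b * s) = a * b * (l * - s) by ring.
apply: ler_wpM2r; first by rewrite mulr_ge0 ?oppr_ge0 ?ltW.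
have : (a + b) ^+ 2 <= alpha ^+ 2.
  by rewrite ler_pXn2r // nnegrE; lra.
have := sqr_ge0 (a - b).
rewrite !expr2; nra.
Qed.

Lemma natr_le_logb (R : realType) (b x : R) (n : nat) :
  1 < b -> b ^+ n <= x -> n%:R <= logb b x.
Proof.
move=> b1 H.
have b0 : 0 < b by lra.
have x0 : 0 < x by apply: lt_le_trans H; rewrite exprn_gt0.
rewrite /logb ler_pdivlMr ?ln_gt0 //.
rewrite mulr_natl -lnXn // ler_ln // posrE exprn_gt0 //.
Qed.

Section NewtonRun.
Context {R : realType} {f : R -> R} {O : R -> R -> R * R * R}.
Context {taus eps alpha : R}.
Hypothesis f_nonincr : nonincreasing_on (Rplus R) f.
Hypothesis taus_min : minimal_root f taus.
Hypothesis alpha_ge1 : 1 <= alpha.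
Hypothesis O_oracle : affine_minorant_oracle f O.

Lemma fpos_lt_root {t} : fpos f t -> t < taus.
Proof.
case: taus_min => taus0 ftaus _ /andP[t0 ft].
rewrite ltNge; apply/negP => le_taus_t.
have := f_nonincr _ _ (mem_set (t0 : Rplus R t))
  (mem_set (taus0 : Rplus R taus)) le_taus_t.
by rewrite ftaus leNgt ft.
Qed.

Lemma f_ge0_before_root {t : R} : 0 <= t -> t <= taus -> 0 <= f t.
Proof.
case: taus_min => taus0 ftaus _ t0 le_t_taus.
have := f_nonincr _ _ (mem_set (taus0 : Rplus R taus))
  (mem_set (t0 : Rplus R t)) le_t_taus.
by rewrite ftaus.
Qed.

Section Step.
Context {t l u s : R}.
Hypothesis ft_pos : fpos f t.
Hypothesis O_t : O t alpha = (l, u, s).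

Lemma oracleP : [/\ 0 < l, l <= f t, f t <= u, u <= alpha * l
  & forall t', 0 <= t' -> l + s * (t' - t) <= f t'].
Proof.
have := O_oracle _ _ ft_pos alpha_ge1; rewrite O_t => -[/andP[l0 lf] fu ul H].
by split=> //; rewrite -ler_pdivrMr.
Qed.

Lemma minorant_le_root : l <= - s * (taus - t).
Proof.
case: oracleP => _ _ _ _ /(_ taus); case: taus_min => taus0 -> _ /(_ taus0).
lra.
Qed.

(** Both [l] and [taus - t] are positive in [minorant_le_root]. This rules out the division by zero
    in [newton_step]. *)
Lemma slope_lt0 : s < 0.
Proof.
case: oracleP => l0 _ _ _ _; have := fpos_lt_root ft_pos; have := minorant_le_root.
nra.
Qed.

(** The new iterate is the zero of a decreasing minorant that is positive at [t] and nonpositive at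
    [taus], so iterates move right without passing the root. *)
Lemma newton_iterate_bounds : t <= t - l / s /\ t - l / s <= taus.
Proof.
case: oracleP => l0 _ _ _ _; have sneg := slope_lt0.
have ls : 0 <= l / - s by rewrite divr_ge0 ?oppr_ge0 ?ltW.
have le : l / - s <= taus - t by rewrite ler_pdivrMr ?oppr_gt0 // mulrC minorant_le_root.
rewrite invrN mulrN in ls le.
by split; lra.
Qed.

Lemma newton_step_fpos (uprev : \bar R) :
  newton_step f O eps alpha (Running t uprev) = Returned t \/
  eps < alpha * l /\
  exists u', newton_step f O eps alpha (Running t uprev) = Running (t - l / s) u'.
Proof.
case/andP: (ft_pos) => t0 ft0; case: oracleP => _ _ _ ul _.
rewrite /newton_step (gt_eqF ft0) andbF ft_pos alpha_ge1 /= O_t.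
case: ifPn => [_|]; first by left.
(* A minimum above [eps] puts the fresh bound [u] above [eps], and [u <= alpha * l]. *)
rewrite -ltNge lt_min lte_fin => /andP[eps_u _]; right.
rewrite (lt_eqF slope_lt0); split; first exact: lt_le_trans ul.
by eexists.
Qed.

Lemma newton_step_product {l' u' s'} :
  fpos f (t - l / s) -> O (t - l / s) alpha = (l', u', s') ->
  l' * - s' <= (alpha / 2) ^+ 2 * (l * - s).
Proof.
move=> ft' O_t'.
case: oracleP => l0 _ fu ul _.
have sneg := slope_lt0.
have [t0 _] := andP ft_pos.
have := O_oracle _ _ ft' alpha_ge1; rewrite O_t' => -[/andP[l'0 _] _ _ minor].
(* Inside this section [slope_lt0] is fixed at [t], so its argument is repeated at the next
   iterate. *)
have s'neg : s' < 0.
  have := fpos_lt_root ft'; case: taus_min => taus0 ftaus _.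
  have := minor _ taus0; rewrite ftaus; nra.
apply: product_contraction => //.
have := minor _ t0; have -> : t - (t - l / s) = l / s by ring.
lra.
Qed.

End Step.

(** Since [tau0 <= t], the moving distance [taus - t] can be replaced by the fixed [taus - tau0]; a
    square root then halves the exponent [2 * k]. *)
Lemma newton_lower_bound {tau0 t l u s c : R} {k : nat} :
  fpos f t -> O t alpha = (l, u, s) -> tau0 <= t -> 0 <= c ->
  l * - s * (taus - tau0) <= (alpha / 2) ^+ (2 * k) * c ^+ 2 ->
  l <= (alpha / 2) ^+ k * c.
Proof.
move=> ft Ot le_t c0 prod.
have [l0 _ _ _ _] := oracleP ft Ot.
have sneg := slope_lt0 ft Ot.
have root := minorant_le_root ft Ot.
have q0 : 0 <= alpha / 2 by apply: divr_ge0 => //; apply: le_trans alpha_ge1.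
rewrite -(@ler_pXn2r _ 2) ?nnegrE ?(ltW l0) ?mulr_ge0 ?exprn_ge0 //.
rewrite exprMn -exprM (mulnC k); apply: le_trans prod.
rewrite expr2 -mulrA ler_wpM2l ?(ltW l0) // (le_trans root) //.
by rewrite ler_wpM2l ?oppr_ge0 ?(ltW sneg) // lerB.
Qed.

End NewtonRun.

Theorem theorem2p4 (R : realType) (f : R -> R)
    (f_convex : convex_function (E := R^o) (Rplus R) f)
    (f_nonincr : nonincreasing_on (Rplus R) f)
    (taus : R) (taus_min : minimal_root f taus)
    (eps : R) (eps_gt0 : 0 < eps)
    (alpha : R) (alpha_gt1 : 1 < alpha) (alpha_lt2 : alpha < 2)
    (tau0 : R) (tau0_ge0 : 0 <= tau0) (f_tau0_gt0 : 0 < f tau0)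
    (O : R -> R -> R * R * R) (O_oracle : affine_minorant_oracle f O)
    (l0 u0 s0 : R) (O_tau0 : O tau0 alpha = (l0, u0, s0)) :
  let C := Num.max (`|s0| * (taus - tau0)) l0 in
  exists N : nat,
    newton_terminates_after f O eps alpha tau0 N /\
    N%:R <= Num.max (1 + logb (2 / alpha) (2 * C / eps)) 2.
Proof.
move=> C; set B := Num.max _ 2.
have alpha_ge1 := ltW alpha_gt1.
have ft0 : fpos f tau0 by rewrite /fpos tau0_ge0.
have [l0_gt0 _ _ _ _] := oracleP alpha_ge1 O_oracle ft0 O_tau0.
have s0_lt0 := slope_lt0 f_nonincr taus_min alpha_ge1 O_oracle ft0 O_tau0.
have tau0_lt := fpos_lt_root f_nonincr taus_min ft0.
have C_gt0 : 0 < C by rewrite lt_max l0_gt0 orbT.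
(* The two terms of the maximum [C] bound the two factors separately. *)
have prod0 : l0 * - s0 * (taus - tau0) <= C ^+ 2.
  rewrite expr2 -mulrA -(ltr0_norm s0_lt0).
  by apply: ler_pM; rewrite ?le_max ?lexx ?orbT ?mulr_ge0 ?subr_ge0 // ltW.
pose run := newton_run f O eps alpha tau0.
pose active k t := fpos f t /\
  forall l u s, O t alpha = (l, u, s) ->
    l * - s <= (alpha / 2) ^+ (2 * k) * (l0 * - s0).
(* The bound is on [n.+1] because iteration [n] is about to be entered and may return, which makes
   the count [n.+1]. *)
pose invariant n := [/\ forall k, (k < n)%N -> exists t u, run k = Running t u,
  n.+1%:R <= B & exists t u,
    [/\ run n = Running t u, tau0 <= t & f t = 0 \/ active n t]].
have step n : invariant n ->
    (exists N, newton_terminates_after f O eps alpha tau0 N /\ N%:R <= B) \/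
    invariant n.+1.
  move=> [before nB [t [u [run_n le_t ft]]]].
  have upto k : (k < n.+1)%N -> exists t u, run k = Running t u.
    rewrite ltnS leq_eqVlt => /orP[/eqP ->|]; last exact: before.
    by exists t, u.
  have runS : run n.+1 = newton_step f O eps alpha (Running t u).
    by rewrite /run /newton_run iterS -/(newton_run _ _ _ _ _ n) -/(run n) run_n.
  have t_ge0 : 0 <= t by apply: le_trans le_t.
  have returned : run n.+1 = Returned t ->
      exists N, newton_terminates_after f O eps alpha tau0 N /\ N%:R <= B.
    by move=> ret; exists n.+1; do 2!split=> //; exists t.
  case: ft => [ft|[ft prod]].
    by left; apply: returned; rewrite runS /newton_step t_ge0 ft eqxx.
  case Ot : (O t alpha) => [[l v] s].
  have sneg := slope_lt0 f_nonincr taus_min alpha_ge1 O_oracle ft Ot.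
  have [le_tt' t'_le] :=
    newton_iterate_bounds f_nonincr taus_min alpha_ge1 O_oracle ft Ot.
  have [] :=
    newton_step_fpos (eps := eps) f_nonincr taus_min alpha_ge1 O_oracle ft Ot u.
    by rewrite -runS => /returned; left.
  rewrite -runS => -[eps_lt [u' run_n1]]; right; split=> //.
    have l_le : l <= (alpha / 2) ^+ n * C.
      apply: (newton_lower_bound f_nonincr taus_min alpha_ge1 O_oracle
        ft Ot le_t (ltW C_gt0)).
      have q_ge0 : 0 <= (alpha / 2) ^+ (2 * n) by apply: exprn_ge0; lra.
      apply: le_trans (ler_wpM2l q_ge0 prod0); rewrite mulrA.
      by apply: ler_wpM2r (prod _ _ _ Ot); rewrite subr_ge0 ltW.
    rewrite /B le_max; apply/orP; left.
    (* It remains to show [eps <= (alpha / 2) ^+ n.+1 * (2 * C)]. The 2 in [2 * C] turns one factor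
       [alpha / 2] into the [alpha] of [eps < alpha * l]. *)
    rewrite -[n.+2%:R]natr1 addrC lerD2l; apply: natr_le_logb.
      by rewrite ltr_pdivlMr; lra.
    rewrite ler_pdivlMr // -invf_div exprVn ler_pdivrMl; last first.
      by apply: exprn_gt0; lra.
    have -> : (alpha / 2) ^+ n.+1 * (2 * C) = alpha * ((alpha / 2) ^+ n * C).
      by rewrite exprS; field.
    by apply: ltW (lt_le_trans eps_lt _); apply: ler_wpM2l => //; lra.
  have t'_ge0 : 0 <= t - l / s by apply: le_trans le_tt'.
  exists (t - l / s), u'; split=> //; first exact: le_trans le_tt'.
  (* Left of the root [f] is nonnegative: either the next iteration returns at once, or the oracle
     may be called again. *)
  have := f_ge0_before_root f_nonincr taus_min t'_ge0 t'_le.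
  rewrite le_eqVlt => /orP[/eqP <-|ft'_gt0]; [by left | right].
  have ft' : fpos f (t - l / s) by rewrite /fpos t'_ge0.
  split=> // l' v' s' Ot'.
  apply: le_trans
    (newton_step_product f_nonincr taus_min alpha_ge1 O_oracle ft Ot ft' Ot') _.
  rewrite mulnS exprD -mulrA; apply: ler_wpM2l (prod _ _ _ Ot).
  by apply: exprn_ge0; lra.
have [//|noN] :=
  pselect (exists N, newton_terminates_after f O eps alpha tau0 N /\ N%:R <= B).
have inv n : invariant n.
  elim: n => [|n IH]; last by case: (step n IH).
  split=> //; first by rewrite /B le_max ler1n orbT.
  exists tau0, +oo%E; split=> //; right; split=> // l u s.
  by rewrite O_tau0 muln0 expr0 mul1r => -[-> _ ->].
(* If no admissible [N] existed, the invariant would hold for every [n], but it fails once [n]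
   exceeds the real number [B]. *)
have [_] := inv (Num.bound B).
rewrite leNgt => /negP[]; have := archi_boundP (_ : 0 <= B).
rewrite /B le_max ler0n orbT => /(_ isT) /lt_le_trans -> //.
by rewrite ler_nat.
Qed.
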